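(* Let $q\ge 2$ be a real number and let $n=2m$ be an even nonnegative integer. Let $\mathcal{Q}_q$ be the distribution on $\mathbb{N}_0$ with mass function $$p_k=\prod_{i\ge 1,\ i\ \mathrm{odd}}(1-1/q^i)\ \frac{q^{2k}}{\prod_{i=1}^{2k}(q^i-1)},\qquad k\in\mathbb{N}_0,$$ and let $\mathcal{Q}_{q,n}$ be the distribution on $\{0,\dots,m\}$ with mass function $$p_{k,n}=\frac{N(n,n-2k)}{q^{\binom n2}},\qquad N(n,2h)=\prod_{i=1}^h\frac{q^{2i-2}}{q^{2i}-1}\prod_{i=0}^{2h-1}(q^{n-i}-1).$$ Then $$\frac{0.18}{q^{n+1}}\le\|\mathcal{Q}_{q,n}-\mathcal{Q}_q\|_{\mathrm{TV}}\le\frac{1.5}{q^{n+1}} .$$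
   Context: $\mathbb{N}_0=\{0,1,2,\dots\}$. Empty products equal $1$. For probability distributions $P_1,P_2$ on a countable set $S$, $\|P_1-P_2\|_{\mathrm{TV}}=\frac12\sum_{s\in S}|P_1(s)-P_2(s)|$; a distribution on $\{0,\dots,m\}$ is regarded as a distribution on $\mathbb{N}_0$. For $q$ a power of $2$, $N(n,2h)$ is the number of symmetric $n\times n$ matrices with zero diagonal over $\mathbb{F}_q$ of rank $2h$; for odd prime powers $q$ it is the number of skew-symmetric $n\times n$ matrices over $\mathbb{F}_q$ of rank $2h$. *)

(* Defs.v *)
From HB Require Import structures.
From mathcomp Require Import all_boot all_order all_algebra.
From mathcomp Require Import all_classical all_reals all_analysis.

Set Implicit Arguments.
Unset Strict Implicit.
Unset Printing Implicit Defensive.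

Import Order.TTheory GRing.Theory Num.Theory.
Import numFieldNormedType.Exports.

Local Open Scope classical_set_scope.
Local Open Scope ring_scope.

(* The sum is taken in \bar R, where a series of nonnegative terms always has
   a meaningful (possibly infinite) value. *)
Definition tv_dist (R : realType) (P1 P2 : nat -> R) : \bar R :=
  ((1 / 2)%:E * \sum_(0 <= k <oo) `|P1 k - P2 k|%:E)%E.

Definition odd_euler_prod (R : realType) (q : R) : R :=
  limn (fun N : nat => \prod_(1 <= i < N | odd i) (1 - 1 / q ^+ i)).

Definition Qlim (R : realType) (q : R) (k : nat) : R :=
  odd_euler_prod q * (q ^+ (2 * k) / \prod_(1 <= i < (2 * k).+1) (q ^+ i - 1)).

(* [alt_count q n h] is N(n, 2h): the last argument is half of the rank. The
   truncated subtractions are exact when 2h <= n. *)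
Definition alt_count (R : realType) (q : R) (n h : nat) : R :=
  \prod_(1 <= i < h.+1) (q ^+ (2 * i - 2) / (q ^+ (2 * i) - 1)) *
  \prod_(0 <= i < 2 * h) (q ^+ (n - i) - 1).

(* Intended for even n, where n - 2k = 2(n/2 - k). *)
Definition Qfin (R : realType) (q : R) (n k : nat) : R :=
  if (k <= n./2)%N then alt_count q n (n./2 - k) / q ^+ 'C(n, 2) else 0.

(* Main.v *)
Require Import Defs.
From mathcomp Require Import all_boot all_order all_algebra.
From mathcomp Require Import all_classical all_reals all_analysis.
From mathcomp Require Import ring lra zify.

Import Order.TTheory GRing.Theory Num.Theory.
Import numFieldNormedType.Exports.

Local Open Scope classical_set_scope.
Local Open Scope ring_scope.

(** Write x for 1/q, w_k for q^(2k) / prod_(1 <= i <= 2k) (q^i - 1), O for the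
product of the factors 1 - x^i over odd i <= n, and E for the same product over
all odd i.  The limit mass at k is w_k E by definition.  Extracting the powers
of q from N(n, n - 2k) shows that the finite mass at k is w_k O B_k, where
B_k = prod_(0 <= j < k) (1 - x^(n - 2j)) ([QfinE]); since B_k contains the
factor 1 - x^0 once k > n/2, this holds for all k.  So the two distributions
differ only by two corrections: O in place of E, which has relative size about
x^(n+1), and B_k, which is trivial at k = 0 and otherwise has its main term
1 - x^n as first factor.

At k = 0 the difference is O - E.  The factor 1 - x^(n+1) of E gives
O - E >= O x^(n+1) >= E x^(n+1), and the geometric series of odd exponents gives
O - E <= 4/3 x^(n+1) ([diff0_bounds]).  Half of this single term already proves
the lower bound, because E >= 0.36 for q >= 2 ([euler_lower]).

At k >= 1 the factor 1 - x^n of B_k outweighs the passage from E to O, so the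
limit mass is the larger one ([Qfin_le_Qlim]), and
  w_k (E - O B_k) <= w_k E (1 - B_k) <= w_k E x^n (q^(2k) - 1) / (q^2 - 1).
The products w_k (q^(2k) - 1) decay by a factor at least 5 at each step
([weight_decay]), and E <= 1 - x, so this is at most 4/3 x^(n+1) 5^-(k-1)
([diffS_bound]).  Summing the geometric series,
  1/2 * 4/3 * (1 + 5/4) x^(n+1) = 3/2 x^(n+1). *)

(** * Factors of the mass functions, and powers of q *)

Definition odd_prod {R : realType} (q : R) (N : nat) : R :=
  \prod_(1 <= i < N | odd i) (1 - 1 / q ^+ i).

Definition limit_weight {R : realType} (q : R) (k : nat) : R :=
  q ^+ (2 * k) / \prod_(1 <= i < (2 * k).+1) (q ^+ i - 1).

(** The factors are 1 - 1/q^(2i) for m - k < i <= m when k <= m; indexing from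
the top makes the factor at j = m vanish, so that the product is 0 for k > m. *)
Definition even_corr {R : realType} (q : R) (m k : nat) : R :=
  \prod_(0 <= j < k) (1 - q ^+ (2 * j) / q ^+ (2 * m)).

Section FixedBase.
Context {R : realType} {q : R} (hq : 2 <= q).

Lemma base_gt0 : 0 < q.
Proof. by apply: lt_le_trans hq; rewrite ltr0n. Qed.

Lemma exp_gt0 i : 0 < q ^+ i.
Proof. exact/exprn_gt0/base_gt0. Qed.

Lemma exp_ge1 i : 1 <= q ^+ i.
Proof. by apply: exprn_ege1; have := hq; lra. Qed.

Lemma exp_gt1 i : 1 < q ^+ i.+1.
Proof. by rewrite exprS; have := exp_ge1 i; have := hq; nra. Qed.

Lemma exp_subr1_gt0 i : (0 < i)%N -> 0 < q ^+ i - 1.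
Proof. by case: i => // i _; rewrite subr_gt0 exp_gt1. Qed.

Lemma inv_exp_le1 i : 1 / q ^+ i <= 1.
Proof. by rewrite ler_pdivrMr ?exp_gt0 // mul1r exp_ge1. Qed.

Lemma inv_exp_gt0 i : 0 < 1 / q ^+ i.
Proof. by rewrite divr_gt0 ?exp_gt0. Qed.

Lemma inv_expS i : 1 / q ^+ i.+1 <= 1 / q ^+ i / 2.
Proof.
rewrite exprS; have := exp_gt0 i; have := hq; move: (q ^+ i) => y hq' y0.
rewrite !ler_pdivrMr ?mulr_gt0 //; last lra.
have -> : 1 / y / 2 * (q * y) = q / 2 by field; apply/eqP; lra.
lra.
Qed.

(** * The limit weights *)

Lemma qpoch_gt0 N : 0 < \prod_(1 <= i < N.+1) (q ^+ i - 1).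
Proof.
rewrite big_nat_cond; apply: prodr_gt0 => i /andP[/andP[i0 _] _].
exact: exp_subr1_gt0.
Qed.

Lemma weight_gt0 k : 0 < limit_weight q k.
Proof. by rewrite divr_gt0 ?exp_gt0 ?qpoch_gt0. Qed.

Lemma weight0 : limit_weight q 0 = 1.
Proof. by rewrite /limit_weight muln0 expr0 big_geq // divr1. Qed.

Lemma weightS k : limit_weight q k.+1 =
  limit_weight q k * (q ^+ 2 / ((q ^+ (2 * k).+1 - 1) * (q ^+ (2 * k).+2 - 1))).
Proof.
rewrite /limit_weight mulnS add2n 2?[in LHS]big_nat_recr //=.
have := exp_subr1_gt0 (2 * k).+1 isT; have := exp_subr1_gt0 (2 * k).+2 isT.
have := qpoch_gt0 (2 * k).
rewrite [q ^+ (2 * k).+2 in LHS](_ : _ = q ^+ 2 * q ^+ (2 * k)); last first.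
  by rewrite -exprD add2n.
move: (\prod_(_ <= _ < _) _) (q ^+ (2 * k).+1 - 1) => P A.
rewrite -exprD add2n; move: (q ^+ (2 * k).+2 - 1) => B B0.
move=> *; rewrite -[(2 * k).+2]add2n exprD; field.
by apply/and3P; split; apply/eqP; lra.
Qed.

(** * The product over odd exponents and its limit *)

Lemma odd_prodS N : odd_prod q N.+2 =
  odd_prod q N.+1 * (if odd N.+1 then 1 - 1 / q ^+ N.+1 else 1).
Proof. by rewrite /odd_prod big_mkcond big_nat_recr //= -big_mkcond. Qed.

Lemma odd_prod1 : odd_prod q 1 = 1.
Proof. by rewrite /odd_prod big_geq. Qed.

Lemma odd_prod_ge0 N : 0 <= odd_prod q N.
Proof. by apply: prodr_ge0 => i _; rewrite subr_ge0 inv_exp_le1. Qed.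

Lemma odd_prod_nonincreasing : nonincreasing_seq (odd_prod q).
Proof.
apply/nonincreasing_seqP => -[|N]; first by rewrite /odd_prod !big_geq.
rewrite odd_prodS; case: ifP => _; rewrite ?mulr1 //.
by rewrite ler_piMr ?odd_prod_ge0 // lerBlDr lerDl ltW ?inv_exp_gt0.
Qed.

Lemma odd_prod_le1 N : odd_prod q N <= 1.
Proof.
have -> : 1 = odd_prod q 0 by rewrite /odd_prod big_geq.
exact: odd_prod_nonincreasing.
Qed.

(** This is prod (1 - u_i) >= 1 - sum u_i, with the partial sum of the u_i
replaced by a difference of two closed forms so that induction applies: for
q >= 2 the sum of 1/q^i over odd i >= b is at most 4/3 * 1/q^b if b is odd, and
at most 2/3 * 1/q^b if b is even. *)
Lemma odd_prod_lower a r : odd a.+1 ->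
  odd_prod q a.+1 * (1 - 4 / 3 * (1 / q ^+ a.+1)) +
  odd_prod q a.+1 * (if odd (a + r).+1 then 4 / 3 else 2 / 3) *
    (1 / q ^+ (a + r).+1) <= odd_prod q (a + r).+1.
Proof.
move=> oa; elim: r => [|r IH]; first by rewrite addn0 oa; lra.
have := inv_expS (a + r).+1; have := inv_exp_gt0 (a + r).+1.
have := odd_prod_ge0 a.+1.
have : odd_prod q (a + r).+1 <= odd_prod q a.+1.
  by apply: odd_prod_nonincreasing; rewrite ltnS leq_addr.
rewrite addnS odd_prodS; move: IH; rewrite [odd (a + r).+2]/=.
rewrite [odd (a + r).+1]/=; case: (odd (a + r)) => /=; nra.
Qed.

Lemma odd_prod_cvg : odd_prod q @ \oo --> odd_euler_prod q.
Proof.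
apply: nonincreasing_is_cvgn; first exact: odd_prod_nonincreasing.
by exists 0 => _ [N _ <-]; exact: odd_prod_ge0.
Qed.

Lemma euler_le N : odd_euler_prod q <= odd_prod q N.
Proof.
apply: nonincreasing_cvgn_ge; first exact: odd_prod_nonincreasing.
apply/cvg_ex; eexists; exact: odd_prod_cvg.
Qed.

Lemma euler_ge a : odd a.+1 ->
  odd_prod q a.+1 * (1 - 4 / 3 * (1 / q ^+ a.+1)) <= odd_euler_prod q.
Proof.
move=> oa; apply: limr_ge; first by apply/cvg_ex; eexists; exact: odd_prod_cvg.
near=> N; have aN : (a.+1 <= N)%N by near: N; exact: nbhs_infty_ge.
have /= := odd_prod_lower a (N - a.+1) oa.
rewrite -addSn subnKC // -/(odd_prod q N).
have := inv_exp_gt0 N; have := odd_prod_ge0 a.+1.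
case: ifP => _; nra.
Unshelve. all: by end_near. Qed.

(** Keeping the factor at 1 and estimating the others by their sum already gives
(1 - 1/2) (1 - 4/3 * 1/8) = 5/12 at q = 2, the worst case. *)
Lemma euler_lower : 36 / 100 <= odd_euler_prod q.
Proof.
apply: le_trans (euler_ge 2 isT).
rewrite !odd_prodS odd_prod1 /=.
have := inv_expS 0; have := inv_expS 1; have := inv_expS 2.
rewrite expr0; have := inv_exp_gt0 3; nra.
Qed.

Lemma euler_upper : odd_euler_prod q <= 1 - 1 / q.
Proof. by apply: le_trans (euler_le 2) _; rewrite odd_prodS odd_prod1 mul1r. Qed.

(** * The correction by even exponents *)

Lemma even_corrS m k : even_corr q m k.+1 =
  even_corr q m k * (1 - q ^+ (2 * k) / q ^+ (2 * m)).
Proof. by rewrite /even_corr big_nat_recr. Qed.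

Lemma even_corr0 m : even_corr q m 0 = 1.
Proof. by rewrite /even_corr big_geq. Qed.

Lemma even_corr_shift m k : even_corr q m.+1 k.+1 =
  (1 - 1 / q ^+ (2 * m.+1)) * even_corr q m k.
Proof.
rewrite /even_corr big_nat_recl // muln0 expr0; congr (_ * _).
apply: eq_bigr => j _; congr (_ - _).
rewrite !mulnS !exprD -mulf_div divff ?mul1r //.
by rewrite gt_eqF ?exp_gt0.
Qed.

Lemma even_corr_eq0 m k : (m < k)%N -> even_corr q m k = 0.
Proof.
elim: k => // k IH; rewrite ltnS leq_eqVlt even_corrS => /predU1P[->|/IH ->].
  by rewrite divff ?subrr ?mulr0 // gt_eqF ?exp_gt0.
by rewrite mul0r.
Qed.

Lemma even_corr_factor m k : (k <= m)%N ->
  0 <= 1 - q ^+ (2 * k) / q ^+ (2 * m) <= 1.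
Proof.
move=> km; rewrite subr_ge0 ler_pdivrMr ?exp_gt0 // mul1r gerBl.
rewrite divr_ge0 ?(ltW (exp_gt0 _)) // andbT.
by apply: ler_weXn2l; [have := hq; lra|rewrite leq_mul2l km orbT].
Qed.

Lemma even_corr_bound m k : 0 <= even_corr q m k <= 1.
Proof.
elim: k => [|k /andP[IH0 IH1]]; first by rewrite even_corr0 ler01 lexx.
have [mk|km] := ltnP m k; first by rewrite (even_corr_eq0 m) ?lexx ?ler01 // ltnW.
have /andP[? ?] := even_corr_factor m k km.
by rewrite even_corrS mulr_ge0 // mulr_ile1.
Qed.

(** The factor at j = 0 alone; the other ones only decrease the product. *)
Lemma even_corr_upper m k : even_corr q m k.+1 <= 1 - 1 / q ^+ (2 * m).
Proof.
elim: k => [|k IH]; first by rewrite even_corrS even_corr0 mul1r muln0 expr0.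
apply: le_trans IH; have [mk|km] := ltnP m k.+1.
  by rewrite !even_corr_eq0 // ltnW.
have /andP[? ?] := even_corr_factor m k.+1 km.
by rewrite even_corrS ler_piMr //; have /andP[] := even_corr_bound m k.+1.
Qed.

(** Again prod (1 - u_j) >= 1 - sum u_j, where the u_j = q^(2j) / q^(2m) form a
geometric progression.  For k > m the product vanishes and the left side is
nonpositive because the sum then contains u_m = 1. *)
Lemma even_corr_lower m k :
  1 - (q ^+ (2 * k) - 1) / ((q ^+ 2 - 1) * q ^+ (2 * m)) <= even_corr q m k.
Proof.
have q2 := exp_subr1_gt0 2 isT; have M0 := exp_gt0 (2 * m).
elim: k => [|k IH].
  by rewrite even_corr0 muln0 expr0 subrr mul0r subr0.
have -> : (q ^+ (2 * k.+1) - 1) / ((q ^+ 2 - 1) * q ^+ (2 * m)) =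
  (q ^+ (2 * k) - 1) / ((q ^+ 2 - 1) * q ^+ (2 * m)) + q ^+ (2 * k) / q ^+ (2 * m).
  rewrite mulnS exprD; field; apply/andP; split; apply/eqP; lra.
have ? : 0 <= q ^+ (2 * k) / q ^+ (2 * m) by rewrite divr_ge0 ?(ltW (exp_gt0 _)).
have [mk|km] := ltnP m k.
  by rewrite even_corr_eq0 in IH; rewrite // even_corr_eq0; [lra|exact: ltnW].
have /andP[? ?] := even_corr_bound m k.
rewrite even_corrS; nra.
Qed.

(** * Factorization of the mass functions *)

(** prod (q^i - 1) = prod q^i * prod (1 - 1/q^i), with the factors of the second
product sorted by the parity of i. *)
Lemma qpoch_split k :
  \prod_(1 <= i < (2 * k).+1) (q ^+ i - 1) =
  q ^+ 'C((2 * k).+1, 2) * (odd_prod q (2 * k).+1 * even_corr q k k).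
Proof.
elim: k => [|k IH].
  by rewrite muln0 big_geq // odd_prod1 even_corr0 !mulr1.
rewrite even_corr_shift mulnS add2n 2?[in LHS]big_nat_recr //= IH.
rewrite !odd_prodS /= mul2n odd_double /= mulr1 -mul2n.
have -> : 'C((2 * k).+3, 2) = ('C((2 * k).+1, 2) + ((2 * k).+1 + (2 * k).+2))%N.
  by rewrite !binS !bin1 !bin0; lia.
rewrite !exprD.
have := exp_gt0 (2 * k).+1; have := exp_gt0 (2 * k).+2.
move: (q ^+ (2 * k).+1) (q ^+ (2 * k).+2) => A B B0 A0.
by field; apply/andP; split; apply/eqP; lra.
Qed.

(** When m grows by one, the factors of the correction shift by one index: one
enters at the top and one leaves at the bottom. *)
Lemma even_corr_step m k :
  even_corr q m.+1 k * (1 - q ^+ (2 * k) / q ^+ (2 * m.+1)) =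
  (1 - 1 / q ^+ (2 * m.+1)) * even_corr q m k.
Proof. by rewrite -even_corrS even_corr_shift. Qed.

Lemma alt_countS n h : alt_count q n.+2 h.+1 =
  alt_count q n h * (q ^+ (2 * h) / (q ^+ (2 * h.+1) - 1)
    * ((q ^+ n.+1 - 1) * (q ^+ n.+2 - 1))).
Proof.
rewrite /alt_count big_nat_recr //= [in X in _ * X = _]mulnS add2n.
rewrite 2!(big_nat_recl _ _ _ (leq0n _)) /= subn0 subSS subn0.
rewrite (_ : (2 * h.+1 - 2 = 2 * h)%N); last lia.
have -> : \prod_(0 <= i < 2 * h) (q ^+ (n.+2 - i.+2) - 1) =
  \prod_(0 <= i < 2 * h) (q ^+ (n - i) - 1) by [].
by move: (\prod_(0 <= _ < _) _) (\prod_(1 <= _ < _) _) => a b; ring.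
Qed.

(** Induction on h, with k fixed: a step adds two rows and columns and raises
the rank by two, which multiplies both sides by the same rational function.  The
case h = 0 is [qpoch_split]. *)
Lemma alt_countE k h : alt_count q (2 * (k + h)) h =
  q ^+ 'C(2 * (k + h), 2) *
  (limit_weight q k * (odd_prod q (2 * (k + h)).+1 * even_corr q (k + h) k)).
Proof.
elim: h => [|h IH].
  rewrite addn0 /alt_count !big_geq // /limit_weight qpoch_split binS bin1 exprD.
  have : odd_prod q (2 * k).+1 * even_corr q k k != 0.
    apply/eqP => P0; have := qpoch_gt0 (2 * k).
    by rewrite qpoch_split P0 mulr0 ltxx.
  have := exp_gt0 'C(2 * k, 2); have := exp_gt0 (2 * k).
  move: (_ * even_corr _ _ _) (q ^+ 'C(_, _)) (q ^+ (2 * k)) => A B C C0 B0 A0.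
  by field; rewrite A0 !gt_eqF.
rewrite addnS [(2 * (k + h).+1)%N in LHS]mulnS add2n alt_countS IH.
set n := (2 * (k + h))%N.
have on : odd n = false by rewrite /n mul2n odd_double.
have n2 : (2 * (k + h).+1 = n.+2)%N by rewrite /n; lia.
rewrite n2 !(odd_prodS n.+1, odd_prodS n) !oddS on /= mulr1.
have /(canRL (mulfK _)) -> := even_corr_step (k + h) k; last first.
  rewrite subr_eq0 eq_sym lt_eqF // ltr_pdivrMr ?exp_gt0 // mul1r.
  by rewrite ltr_eXn2l; [lia|have := hq; lra].
have -> : 'C(n.+2, 2) = ('C(n, 2) + (n + n.+1))%N.
  by rewrite !binS !bin1 !bin0; lia.
have -> : (2 * (k + h).+1)%N = (2 * h.+1 + 2 * k)%N by lia.
have -> : n.+2 = (2 * h.+1 + 2 * k)%N by rewrite /n; lia.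
have := exp_subr1_gt0 (2 * h.+1) isT.
have -> : n.+1 = (n + 1)%N by lia.
have -> : n = (2 * h + 2 * k)%N by rewrite /n; lia.
have -> : (2 * h.+1 = 2 * h + 2)%N by lia.
move: (2 * h)%N (2 * k)%N => a b; rewrite !exprD !expr1.
have := exp_gt0 a; have := exp_gt0 b; have := base_gt0.
move: (q ^+ a) (q ^+ b) => A B q0 B0 A0 den.
by field; rewrite !gt_eqF.
Qed.

Lemma QfinE m k : Qfin q (2 * m) k =
  limit_weight q k * (odd_prod q (2 * m).+1 * even_corr q m k).
Proof.
rewrite /Qfin mul2n doubleK -mul2n; case: leqP => [km|mk]; last first.
  by rewrite even_corr_eq0 // !mulr0.
have := alt_countE k (m - k); rewrite subnKC // => ->.
by rewrite mulrAC divff ?mul1r // gt_eqF ?exp_gt0.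
Qed.

Lemma QlimE k : Qlim q k = limit_weight q k * odd_euler_prod q.
Proof. exact: mulrC. Qed.

(** * Termwise comparison *)

(** The factor q^(2k+2) - 1 is the estimate of 1 - B_(k+1).  Consecutive terms
have ratio q^2 / ((q^(2k+2) - 1) (q^(2k+3) - 1)), at most
q^2 / ((q^2 - 1) (q^3 - 1)) <= 4/21 < 1/5. *)
Lemma weight_decay k : limit_weight q k.+1 * (q ^+ (2 * k.+1) - 1) <=
  q ^+ 2 / (q - 1) * (1 / 5) ^+ k.
Proof.
elim: k => [|k IH].
  rewrite weightS weight0 muln0 expr0 mul1r muln1 mulr1 expr1.
  have := exp_subr1_gt0 2 isT => ?; have := hq => ?.
  rewrite le_eqVlt; apply/orP; left.
  by apply/eqP; field; apply/andP; split; apply/eqP; lra.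
have -> : q ^+ 2 / (q - 1) * (1 / 5) ^+ k.+1 =
  q ^+ 2 / (q - 1) * (1 / 5) ^+ k * (1 / 5).
  by rewrite [(1 / 5) ^+ k.+1]exprSr; ring.
apply: (@le_trans _ _ (limit_weight q k.+1 * (q ^+ (2 * k.+1) - 1) * (1 / 5)));
  last by rewrite ler_pM2r.
have qA : q ^+ 2 <= q ^+ (2 * k.+1).
  by apply: ler_weXn2l; [have := hq; lra|lia].
have qB : q ^+ 3 <= q ^+ (2 * k.+1).+1.
  by apply: ler_weXn2l; [have := hq; lra|lia].
have w0 := weight_gt0 k.+1; have C0 := exp_subr1_gt0 (2 * k.+2) isT.
rewrite weightS.
move: C0; rewrite [(2 * k.+2)%N]mulnS add2n => C0.
have q2 : 4 <= q ^+ 2 by rewrite expr2; have := hq; nra.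
have q3 : 8 <= q ^+ 3 by rewrite exprSr; have := hq; nra.
move: qA qB C0 w0 q2 q3; move: (q ^+ 3) (q ^+ (2 * k.+1)).
move: (q ^+ (2 * k.+1).+1) (q ^+ (2 * k.+1).+2).
move: (q ^+ 2) (limit_weight _ _) => Q w B C Q3 A.
move=> QA QB C0 w0 Q4 Q8.
have -> : w * (Q / ((B - 1) * (C - 1))) * (C - 1) = w * (Q / (B - 1)).
  by field; apply/andP; split; apply/eqP; lra.
rewrite -mulrA ler_pM2l // ler_pdivrMr; last lra.
nra.
Qed.

Lemma diff0_bounds m :
  odd_prod q (2 * m).+1 / q ^+ (2 * m).+1 <= Qfin q (2 * m) 0 - Qlim q 0
  <= 4 / 3 * (1 / q ^+ (2 * m).+1).
Proof.
have oddm : odd (2 * m).+1 by rewrite /= mul2n odd_double.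
rewrite QfinE QlimE weight0 even_corr0 !mul1r mulr1.
have := euler_le (2 * m).+2; rewrite odd_prodS oddm.
have := euler_ge (2 * m) oddm.
have := odd_prod_ge0 (2 * m).+1; have := odd_prod_le1 (2 * m).+1.
have := inv_exp_gt0 (2 * m).+1; rewrite div1r => *.
apply/andP; split; nra.
Qed.

(** The finite mass carries the factor 1 - y with y = 1/q^(2m), whereas passing
from the partial product to its limit costs at most the factor
1 - 4/3 * y/q >= 1 - 2/3 * y. *)
Lemma Qfin_le_Qlim m k : Qfin q (2 * m) k.+1 <= Qlim q k.+1.
Proof.
have oddm : odd (2 * m).+1 by rewrite /= mul2n odd_double.
rewrite QfinE QlimE ler_pM2l ?weight_gt0 //.
have := euler_ge (2 * m) oddm; have := even_corr_upper m k.
have := inv_expS (2 * m); have := inv_exp_gt0 (2 * m).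
have := odd_prod_ge0 (2 * m).+1; nra.
Qed.

(** The partial product is bounded below by its limit E, so the difference is at
most E times the estimate of 1 - B_(k+1) times the weight; E <= 1 - 1/q and
[weight_decay] leave the constant q^2 / (q^2 - 1) <= 4/3. *)
Lemma diffS_bound m k : `|Qfin q (2 * m) k.+1 - Qlim q k.+1| <=
  4 / 3 * (1 / q ^+ (2 * m).+1) * (1 / 5) ^+ k.
Proof.
rewrite ler0_norm ?subr_le0 ?Qfin_le_Qlim // opprB.
set E := odd_euler_prod q; set y := q ^+ (2 * m).
have y0 : 0 < y := exp_gt0 _.
have q2 := exp_subr1_gt0 2 isT.
have E0 : 0 <= E by have := euler_lower; rewrite -/E; lra.
have w0 := weight_gt0 k.+1.
apply: (@le_trans _ _ (E / ((q ^+ 2 - 1) * y) *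
    (limit_weight q k.+1 * (q ^+ (2 * k.+1) - 1)))).
  rewrite QfinE QlimE -/E -mulrBr mulrCA ler_pM2l // -mulrA.
  have := even_corr_lower m k.+1; rewrite -/y [_ / (_ * y)]mulrC.
  have := euler_le (2 * m).+1; rewrite -/E.
  have /andP[] := even_corr_bound m k.+1.
  move: (_^-1 * _) (odd_prod _ _) (even_corr _ _ _) => *; nra.
apply: (@le_trans _ _ ((1 - 1 / q) / ((q ^+ 2 - 1) * y) *
    (q ^+ 2 / (q - 1) * (1 / 5) ^+ k))).
  apply: ler_pM (weight_decay k).
  - by rewrite divr_ge0 // mulr_ge0 // ltW.
  - by rewrite mulr_ge0 // ltW // exp_subr1_gt0.
  - by rewrite ler_pM2r ?invr_gt0 ?mulr_gt0 // euler_upper.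
rewrite [leLHS]mulrA; apply: ler_wpM2r; first by rewrite exprn_ge0.
rewrite (exprSr q (2 * m)) -/y; have := hq => ?.
have -> : (1 - 1 / q) / ((q ^+ 2 - 1) * y) * (q ^+ 2 / (q - 1)) =
   (q / (q ^+ 2 - 1)) / y.
  by field; apply/and4P; split; apply/eqP; lra.
have -> : 4 / 3 * (1 / (y * q)) = (4 / (3 * q)) / y.
  by field; apply/andP; split; apply/eqP; lra.
rewrite ler_pM2r ?invr_gt0 // ler_pdivrMr // mulrAC ler_pdivlMr; last lra.
rewrite expr2; nra.
Qed.

(** 3 - 5/3 * 5^-N is 4/3 * (1 + (1 + 1/5 + ... + 5^-(N-1))): the term at 0,
then the geometric sum of [diffS_bound]. *)
Lemma partial_sum_bound m N :
  \sum_(0 <= k < N.+1) `|Qfin q (2 * m) k - Qlim q k| <=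
  1 / q ^+ (2 * m).+1 * (3 - 5 / 3 * (1 / 5) ^+ N).
Proof.
elim: N => [|N IH].
  have y0 := inv_exp_gt0 (2 * m).+1; have := odd_prod_ge0 (2 * m).+1 => O0.
  have /andP[d1 d2] := diff0_bounds m.
  rewrite big_nat1 expr0 ger0_norm; first by lra.
  by apply: le_trans d1; rewrite divr_ge0 // ltW // exp_gt0.
rewrite big_nat_recr //=; have := diffS_bound m N.
move: IH; rewrite [(1 / 5) ^+ N.+1]exprS; lra.
Qed.

End FixedBase.

Theorem theorem5p1 (R : realType) (q : R) (n m : nat)
  (hq : 2 <= q) (hn : n = (2 * m)%N) :
  (((18 / 100) / q ^+ n.+1)%:E <= tv_dist (Qfin q n) (Qlim q))%E /\
  (tv_dist (Qfin q n) (Qlim q) <= ((15 / 10) / q ^+ n.+1)%:E)%E.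
Proof.
subst n; rewrite /tv_dist.
set f : nat -> R := fun k => `|Qfin q (2 * m) k - Qlim q k|.
have y0 : 0 < 1 / q ^+ (2 * m).+1 := inv_exp_gt0 hq _.
have f0 k : (0 <= (f k)%:E)%E by rewrite lee_fin normr_ge0.
split.
- have lb : (((36 / 100) / q ^+ (2 * m).+1)%:E <= (f 0%N)%:E)%E.
    rewrite lee_fin /f; have /andP[d1 _] := diff0_bounds hq m.
    apply: le_trans (ler_norm _); apply: le_trans d1.
    rewrite ler_pM2r; last by rewrite -div1r.
    exact: le_trans (euler_lower hq) (euler_le hq _).
  have -> : (18 / 100) / q ^+ (2 * m).+1 = 1 / 2 * ((36 / 100) / q ^+ (2 * m).+1).
    lra.
  rewrite (EFinM (1 / 2)) lee_pmul2l ?lte_fin //.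
  apply: le_trans lb _.
  have := @nneseries_lim_ge R (fun k => (f k)%:E) predT 0 1 (fun k _ _ => f0 k).
  by rewrite big_nat1.
- have -> : (15 / 10) / q ^+ (2 * m).+1 = 1 / 2 * (3 / q ^+ (2 * m).+1) by lra.
  rewrite (EFinM (1 / 2)) lee_pmul2l ?lte_fin //.
  apply: lime_le; first by apply: is_cvg_nneseries => k _ _; exact: f0.
  apply: nearW => -[|N].
    by rewrite big_geq // lee_fin; lra.
  rewrite sumEFin lee_fin; apply: le_trans (partial_sum_bound hq m N) _.
  have : 0 <= (1 / 5 : R) ^+ N by rewrite exprn_ge0.
  have := y0; nra.
Qed.
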